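(* Let $0<c<C<\infty$ and for $i=1,2$ let $L^i,R^i:[0,\infty)\times\mathbb{R}\to\mathbb{R}$ satisfy: (i) for each $x\in\mathbb{R}$, $L^i(\cdot,x),R^i(\cdot,x)\in D[0,\infty)$; (ii) for each $t\ge 0$, $L^i(t,\cdot)$ and $R^i(t,\cdot)$ are strictly increasing; (iii) $c|x-y|\le |L^i(t,x)-L^i(t,y)|\le C|x-y|$ and $c|x-y|\le |R^i(t,x)-R^i(t,y)|\le C|x-y|$ for all $t\ge 0$, $x,y\in\mathbb{R}$; (iv) $\inf_{(t,x)\in[0,\infty)\times\mathbb{R}}(R^i(t,x)-L^i(t,x))>0$. Let $S^1,S^2\in D[0,\infty)$ and let $(X^i,K^i)$ be the solution of the Skorokhod problem $\mathbb{SP}_{L^i}^{R^i}(S^i)$, $i=1,2$. Then for every $T>0$, $$\sup_{t\in[0,T]}|K^1_t-K^2_t|\le \frac{C}{c}\sup_{t\in[0,T]}|S^1_t-S^2_t|+\frac{1}{c}\max(\bar{L}_T,\bar{R}_T),$$ where $\bar{L}_T=\sup_{(t,x)\in[0,T]\times\mathbb{R}}|L^1(t,x)-L^2(t,x)|$ and $\bar{R}_T=\sup_{(t,x)\in[0,T]\times\mathbb{R}}|R^1(t,x)-R^2(t,x)|$ (values in $[0,\infty]$).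
   Context: $D[0,\infty)$ is the set of real-valued right-continuous functions on $[0,\infty)$ with left limits; $BV[0,\infty)$ is the set of $K\in D[0,\infty)$ of bounded variation on each compact interval. Skorokhod problem $\mathbb{SP}_L^R(S)$: a pair $(X,K)\in D[0,\infty)\times BV[0,\infty)$ is a solution if (a) $X_t=S_t+K_t$ for all $t\ge0$; (b) $L(t,X_t)\le 0\le R(t,X_t)$ for all $t\ge 0$; (c) $K_{0-}=0$ and $K=K^r-K^l$, where $K^r,K^l$ are nondecreasing (right-continuous, with $K^r_{0-}=K^l_{0-}=0$) and $\int_0^\infty I_{\{L(s,X_s)<0\}}dK^l_s=0$, $\int_0^\infty I_{\{R(s,X_s)>0\}}dK^r_s=0$. The integrals are over $[0,\infty)$ including time $0$, where $dK^r,dK^l$ have atoms of mass $K^r_0,K^l_0$. Under hypotheses (i)–(iv), this problem has a unique solution, and in fact $$K_t=-\max\left((-\Phi_0)^+\wedge \inf_{r\in[0,t]}(-\Psi_r),\ \sup_{s\in[0,t]}\left[(-\Phi_s)\wedge \inf_{r\in[s,t]}(-\Psi_r)\right] \right),$$ where $\Phi_t,\Psi_t$ are the unique reals with $L(t,S_t+\Phi_t)=0$, $R(t,S_t+\Psi_t)=0$. *)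

(* Defs.v *)
From HB Require Import structures.
From mathcomp Require Import all_boot all_order all_algebra.
From mathcomp Require Import all_classical all_reals all_analysis.

Set Implicit Arguments.
Unset Strict Implicit.
Unset Printing Implicit Defensive.

Import Order.TTheory GRing.Theory Num.Theory.
Import numFieldNormedType.Exports.

Local Open Scope classical_set_scope.
Local Open Scope ring_scope.

(* A path on [0, +oo) is a function R -> R whose values at negative times are
   irrelevant, except in [skorokhod_solution], where the values of K, Kr and Kl
   at negative times encode the convention on the value at 0-. *)

Definition cadlag {R : realType} (f : R -> R) : Prop :=
  (forall t, 0 <= t -> f x @[x --> t^'+] --> f t) /\
  (forall t, 0 < t -> cvg (f x @[x --> t^'-])).

Definition locally_bounded_variation {R : realType} (f : R -> R) : Prop :=
  forall a b, 0 <= a -> a <= b -> bounded_variation a b f.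

Definition bi_lipschitz {R : realType} (c C : R) (F : R -> R -> R) : Prop :=
  forall t x y, 0 <= t ->
    c * `|x - y| <= `|F t x - F t y| /\ `|F t x - F t y| <= C * `|x - y|.

Record barriers {R : realType} (c C : R) (L U : R -> R -> R) : Prop :=
  Barriers {
    lower_cadlag : forall x, cadlag (L ^~ x) ;
    upper_cadlag : forall x, cadlag (U ^~ x) ;
    lower_increasing : forall t, 0 <= t -> {homo L t : x y / x < y} ;
    upper_increasing : forall t, 0 <= t -> {homo U t : x y / x < y} ;
    lower_bi_lipschitz : bi_lipschitz c C L ;
    upper_bi_lipschitz : bi_lipschitz c C U ;
    barriers_separated :
      (0 < ereal_inf [set (U p.1 p.2 - L p.1 p.2)%:E
                     | p in `[0%R, +oo[ `*` [set: R]])%E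
  }.

(* Kr and Kl are nondecreasing and right-continuous on the whole line and
   vanish on (-oo, 0), so they are nonnegative at 0 and their
   Lebesgue-Stieltjes measures have atoms of mass Kr 0 and Kl 0 at 0. *)
Record skorokhod_solution {R : realType} (L U : R -> R -> R)
    (S X K : R -> R) : Prop := SkorokhodSolution {
  solution_cadlagX : cadlag X ;
  solution_cadlagK : cadlag K ;
  solution_bvK : locally_bounded_variation K ;
  solution_decomposition : forall t, 0 <= t -> X t = S t + K t ;
  solution_between : forall t, 0 <= t -> L t (X t) <= 0 /\ 0 <= U t (X t) ;
  solution_at0 : forall t, t < 0 -> K t = 0 ;
  solution_minimal : exists Kr Kl : cumulative R R,
    [/\ forall t, t < 0 -> Kr t = 0 /\ Kl t = 0,
        forall t, 0 <= t -> K t = Kr t - Kl t,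
        (\int[lebesgue_stieltjes_measure Kl]_(s in `[0%R, +oo[)
           (\1_[set u : R | L u (X u) < 0] s)%:E = 0)%E &
        (\int[lebesgue_stieltjes_measure Kr]_(s in `[0%R, +oo[)
           (\1_[set u : R | 0 < U u (X u)] s)%:E = 0)%E]
}.

Definition sup_dist {R : realType} (T : R) (f g : R -> R) : \bar R :=
  ereal_sup [set `|f t - g t|%:E | t in `[0%R, T]].

Definition sup_dist2 {R : realType} (T : R) (F G : R -> R -> R) : \bar R :=
  ereal_sup [set `|F p.1 p.2 - G p.1 p.2|%:E | p in `[0%R, T] `*` [set: R]].

(* Main.v *)
(* The upward regulator [Kr] can only grow where [U t (X t) <= 0], and the
   downward one [Kl] only where [0 <= L t (X t)]. If [K1 - K2] exceeds
   [M := sup |S1 - S2| + max (sup |L1 - L2|, sup |U1 - U2|) / c] at time [u],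
   then [U1 u (X1 u) > 0] and [L2 u (X2 u) < 0], so that neither [Kr1] nor
   [Kl2] grows and [K1 - K2] is nonincreasing there. As [K1 - K2] starts from
   [0] at time [0-], it never exceeds [M]: compare [t] with the last time [s]
   before [t] at which [K1 - K2 <= M], jumps at [s] included. Finally,
   exchange the two problems, and note that [1 <= C / c]. *)

Require Import Defs.
From mathcomp Require Import all_boot all_order all_algebra.
From mathcomp Require Import all_classical all_reals all_analysis.
From mathcomp Require Import lra.
Import Order.TTheory GRing.Theory Num.Theory.
Import numFieldNormedType.Exports.
Local Open Scope classical_set_scope.
Local Open Scope ring_scope.

Lemma lebesgue_stieltjes_measure_itvoc (R : realType) (f : cumulative R R)
    (a b : R) : a <= b ->
  lebesgue_stieltjes_measure f `]a, b]%classic = (f b - f a)%:E.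
Proof.
move=> ab; rewrite /lebesgue_stieltjes_measure/= /measure_extension/=.
rewrite measurable_mu_extE//; first exact: wlength_itv_bnd.
exact: is_ocitv.
Qed.

Section integral_indic_inner.
Import HBNNSimple.

(* No measurability of [A] is needed: for a nonnegative function the integral
   is a supremum over the simple functions below it. *)
Lemma le_measure_integral_indic d (T : measurableType d) (R : realType)
    (mu : {measure set T -> \bar R}) (A B D : set T) :
  measurable B -> B `<=` A -> B `<=` D ->
  (mu B <= \int[mu]_(x in D) (\1_A x)%:E)%E.
Proof.
move=> mB BA BD.
rewrite -[B in leLHS]setIT -integral_indic//.
rewrite (_ : \1_B = indic_nnsfun R mB :> (T -> R))// integralT_nnsfun.
rewrite ge0_integralE; last by move=> x _; rewrite lee_fin indicE.
apply: ereal_sup_ubound => /=; exists (indic_nnsfun R mB) => // x.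
rewrite (_ : indic_nnsfun R mB x = \1_B x)// indicE patchE.
case: (boolP (x \in B)) => [/set_mem Bx|_].
  by rewrite (mem_set (BD _ Bx)) indicE (mem_set (BA _ Bx)).
by case: ifP; rewrite lee_fin.
Qed.

End integral_indic_inner.

Section flat_off_support.
Context {R : realType} {f : cumulative R R} {A : set R}.
Hypothesis fA : (\int[lebesgue_stieltjes_measure f]_(s in `[0%R, +oo[)
  (\1_A s)%:E = 0)%E.

(** The integral in [fA] dominates the mass of [B], and that integral vanishes. *)
Let null (B : set (measurableTypeR R)) : measurable B -> B `<=` A ->
  B `<=` `[0%R, +oo[ -> lebesgue_stieltjes_measure f B = 0%E.
Proof.
move=> mB BA B0; apply/eqP; rewrite eq_le measure_ge0 andbT -fA.
exact: (@le_measure_integral_indic _ _ _ (lebesgue_stieltjes_measure f)).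
Qed.

Lemma flat_itvoc (s t : R) : 0 <= s -> s <= t -> `]s, t] `<=` A -> f t = f s.
Proof.
move=> s0 st stA; apply/eqP; rewrite -subr_eq0 -eqe.
rewrite -lebesgue_stieltjes_measure_itvoc// null//.
by move=> x /=; rewrite !in_itv/= andbT => /andP[/ltW/(le_trans s0)].
Qed.

(** Closing the interval at [s] also rules out a jump there. As [[s, t]] is the decreasing
    intersection of the sets []s - 1/(n+1), t]], continuity from above makes [f t - f (s - 1/(n+1))]
    tend to 0. For [s = 0] the points [u] may be negative, which covers the atom at time 0. *)
Lemma flat_itvcc (s t e : R) : 0 <= s -> s <= t -> `[s, t] `<=` A -> 0 < e ->
  exists2 d : R, 0 < d & forall u : R, s - d < u -> f t - f u < e.
Proof.
move=> s0 st stA e0.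
pose F n : set (measurableTypeR R) := `]s - n.+1%:R^-1, t]%classic.
have sn n : s - n.+1%:R^-1 <= t.
  by rewrite (le_trans _ st)// lerBlDr lerDl invr_ge0.
have mF n : measurable (F n) by exact: measurable_itv.
have FE : \bigcap_n F n = `[s, t]%classic.
  apply/seteqP; split => [x Fx|x /=]; last first.
    rewrite in_itv/= => /andP[sx xt] n _; rewrite /F/= in_itv/= xt andbT.
    by rewrite (lt_le_trans _ sx)// ltrBlDr ltrDl invr_gt0.
  have := Fx 0%N I; rewrite /F/= !in_itv/= => /andP[_ ->]; rewrite andbT.
  apply/ler_addgt0Pr => d d0.
  have [n _ /(_ n (leqnn n)) nd] := near_infty_natSinv_lt (PosNum d0).
  have := Fx n I; rewrite /F/= in_itv/= => /andP[snx _].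
  rewrite -lerBlDr (le_trans _ (ltW snx))// lerB//; exact: ltW nd.
have mu0 : lebesgue_stieltjes_measure f (\bigcap_n F n) = 0%E.
  rewrite FE null//.
  by move=> x /=; rewrite !in_itv/= andbT => /andP[/(le_trans s0)].
have : lebesgue_stieltjes_measure f \o F @ \oo --> 0%E.
  rewrite -mu0; apply: nonincreasing_cvg_mu => //.
  - by rewrite /F/= lebesgue_stieltjes_measure_itvoc// ltry.
  - by rewrite FE; exact: measurable_itv.
  - move=> m n mn; apply/subsetPset => x; rewrite /F/= !in_itv/=.
    case/andP => snx ->; rewrite andbT (le_lt_trans _ snx)// lerB//.
    by rewrite lef_pV2 ?posrE// ler_nat.
have -> : lebesgue_stieltjes_measure f \o F =
    EFin \o (fun n => f t - f (s - n.+1%:R^-1)).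
  by apply/funext => n; rewrite /= lebesgue_stieltjes_measure_itvoc.
move/fine_cvgP => -[_ /cvgrPdist_lt /(_ _ e0)[n _ /(_ n (leqnn n))]] /=.
rewrite sub0r normrN => /(le_lt_trans (ler_norm _)) fe.
(* One index suffices: monotonicity of [f] extends the estimate to every [u] to the right of
   [s - 1/(n+1)]. *)
exists n.+1%:R^-1 => [|u su]; first by rewrite invr_gt0.
rewrite (le_lt_trans _ fe)// lerB//.
by apply: cumulative_is_nondecreasing; exact: ltW.
Qed.

End flat_off_support.

Section comparison.
Context {R : realType} {c C : R} {L1 U1 L2 U2 : R -> R -> R}.
Hypotheses (c0 : 0 < c)
  (hB1 : barriers c C L1 U1) (hB2 : barriers c C L2 U2).
Context {S1 S2 X1 K1 X2 K2 : R -> R}.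
Hypotheses (hXK1 : skorokhod_solution L1 U1 S1 X1 K1)
  (hXK2 : skorokhod_solution L2 U2 S2 X2 K2).

(** The gap gives [X1 u - X2 u > B / c], so [U1 u] and [L2 u] each gain more than [B] from [X2 u] to
    [X1 u]. But [U1 u (X2 u) >= - B] because [U2 u (X2 u) >= 0], and [L2 u (X1 u) <= B] because
    [L1 u (X1 u) <= 0]. *)
Lemma inactive_above (E B u : R) : 0 <= u ->
  `|S1 u - S2 u| <= E ->
  `|L1 u (X1 u) - L2 u (X1 u)| <= B -> `|U1 u (X2 u) - U2 u (X2 u)| <= B ->
  E + B / c < K1 u - K2 u ->
  0 < U1 u (X1 u) /\ L2 u (X2 u) < 0.
Proof.
move=> u0 SE LB UB KM.
have B0 : 0 <= B := le_trans (normr_ge0 _) LB.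
have XX : B / c < X1 u - X2 u.
  rewrite (solution_decomposition hXK1 u0) (solution_decomposition hXK2 u0).
  by move: SE; rewrite ler_norml => /andP[]; lra.
have X21 : X2 u < X1 u by rewrite -subr_gt0 (le_lt_trans _ XX)// divr_ge0// ltW.
have Bc : B < c * (X1 u - X2 u) by rewrite mulrC -ltr_pdivrMr.
have [U1c _] := upper_bi_lipschitz hB1 (X1 u) (X2 u) u0.
have [L2c _] := lower_bi_lipschitz hB2 (X1 u) (X2 u) u0.
have [L1X1 _] := solution_between hXK1 u0.
have [_ U2X2] := solution_between hXK2 u0.
have U1i := upper_increasing hB1 u0 X21.
have L2i := lower_increasing hB2 u0 X21.
move: U1c L2c LB UB; rewrite !ler_norml.
rewrite !gtr0_norm ?subr_gt0// => U1c L2c /andP[LB _] /andP[UB _]; lra.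
Qed.

Lemma increment_bound (E B T t : R) :
  (forall u : R, 0 <= u <= T -> `|S1 u - S2 u| <= E) ->
  (forall u x : R, 0 <= u <= T -> `|L1 u x - L2 u x| <= B) ->
  (forall u x : R, 0 <= u <= T -> `|U1 u x - U2 u x| <= B) ->
  0 <= t <= T -> K1 t - K2 t <= E + B / c.
Proof.
move=> SE LB UB /andP[t0 tT]; rewrite leNgt; apply/negP => tM.
set M := E + B / c in tM *.
have T0 : (0 : R) <= 0 <= T by rewrite lexx (le_trans t0).
have M0 : 0 <= M.
  rewrite addr_ge0 ?(le_trans (normr_ge0 _) (SE _ T0))// divr_ge0 ?(ltW c0)//.
  exact: le_trans (normr_ge0 _) (LB _ 0 T0).
have off u : 0 <= u -> u <= t -> M < K1 u - K2 u ->
    0 < U1 u (X1 u) /\ L2 u (X2 u) < 0.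
  move=> u0 ut; have uT : 0 <= u <= T by rewrite u0 (le_trans ut).
  by apply: inactive_above; [|exact: SE|exact: LB|exact: UB].
have [Kr1 [Kl1 [n1 K1E _ iKr1]]] := solution_minimal hXK1.
have [Kr2 [Kl2 [n2 K2E iKl2 _]]] := solution_minimal hXK2.
(* Both sides vanish at negative times, which are needed below when [s = 0]. *)
have K1E' u : K1 u = Kr1 u - Kl1 u.
  have [/K1E//|u0] := leP 0 u.
  by have [-> ->] := n1 _ u0; rewrite subrr (solution_at0 hXK1).
have K2E' u : K2 u = Kr2 u - Kl2 u.
  have [/K2E//|u0] := leP 0 u.
  by have [-> ->] := n2 _ u0; rewrite subrr (solution_at0 hXK2).
(* Since [0 <= M], the set [A] contains all negative times; hence it is nonempty and its supremum
   [s] is nonnegative. *)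
pose A := [set u | u <= t /\ K1 u - K2 u <= M].
have negA u : u < 0 -> A u.
  move=> u0; split; first by rewrite (le_trans (ltW u0)).
  by rewrite (solution_at0 hXK1)// (solution_at0 hXK2)// subrr.
have supA : has_sup A.
  by split; [exists (-1); exact: negA | exists t => u []].
pose s := sup A.
have st : s <= t by apply: ge_sup; [exact: supA.1|move=> u []].
have s0 : 0 <= s.
  rewrite leNgt; apply/negP => s0.
  have : s / 2 <= s by apply: ub_le_sup; [exact: supA.2|apply: negA; lra].
  lra.
have aboves u : s < u -> u <= t -> M < K1 u - K2 u.
  move=> su ut; rewrite ltNge; apply/negP => uM.
  have : u <= s by apply: ub_le_sup; [exact: supA.2|].
  by rewrite leNgt su.
have nd (f : cumulative R R) u v : u <= v -> f u <= f v.
  exact: cumulative_is_nondecreasing.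
(* The increments of [Kl1] and [Kr2] enter with a minus sign and are dropped. *)
have stepM u : u <= t -> K1 u - K2 u <= M ->
    K1 t - K2 t <= M + (Kr1 t - Kr1 u) + (Kl2 t - Kl2 u).
  move=> ut; rewrite !K1E' !K2E'.
  by have := nd Kl1 _ _ ut; have := nd Kr2 _ _ ut; lra.
(* If [s] lies in [A], flatness on []s, t]] suffices. Otherwise [K1 - K2] already exceeds [M] at
   [s], and the comparison starts from points of [A] just before [s]. *)
have [sM|sM] := leP (K1 s - K2 s) M.
  have offs u : `]s, t]%classic u -> 0 < U1 u (X1 u) /\ L2 u (X2 u) < 0.
    rewrite /= in_itv/= => /andP[su ut].
    by apply: off => //; [rewrite (le_trans s0)// ltW|exact: aboves].
  have r1 : Kr1 t = Kr1 s by apply: (flat_itvoc iKr1) => // u /offs[].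
  have l2 : Kl2 t = Kl2 s by apply: (flat_itvoc iKl2) => // u /offs[].
  by have := stepM _ st sM; rewrite r1 l2; lra.
have offs u : `[s, t]%classic u -> 0 < U1 u (X1 u) /\ L2 u (X2 u) < 0.
  rewrite /= in_itv/= => /andP[su ut]; apply: off => //.
    exact: le_trans s0 su.
  by move: su; rewrite le_eqVlt => /predU1P[<-//|su]; exact: aboves.
(* Each of [Kr1] and [Kl2] is allowed half of the excess over [M]. *)
have e0 : 0 < (K1 t - K2 t - M) / 2 by lra.
have [d1 d10 r1] := flat_itvcc iKr1 _ _ _ s0 st (fun u h => (offs u h).1) e0.
have [d2 d20 l2] := flat_itvcc iKl2 _ _ _ s0 st (fun u h => (offs u h).2) e0.
have d0 : 0 < Num.min d1 d2 by rewrite lt_min d10.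
have [u [ut uM] su] := sup_adherent d0 supA.
have := stepM _ ut uM.
have /r1 : s - d1 < u by rewrite (le_lt_trans _ su)// lerB// ge_min lexx.
have /l2 : s - d2 < u by rewrite (le_lt_trans _ su)// lerB// ge_min lexx orbT.
lra.
Qed.

End comparison.

Lemma sup_distP (R : realType) (T E : R) (f g : R -> R) :
  sup_dist T f g = E%:E -> forall t, 0 <= t <= T -> `|f t - g t| <= E.
Proof.
move=> fgE t tT; rewrite -lee_fin -fgE; apply: ereal_sup_ubound.
by exists t => //=; rewrite in_itv.
Qed.

Lemma sup_dist2_ge (R : realType) (T t x : R) (F G : R -> R -> R) :
  0 <= t <= T -> (`|F t x - G t x|%:E <= sup_dist2 T F G)%E.
Proof.
move=> tT; apply: ereal_sup_ubound.
by exists (t, x) => //=; split => //=; rewrite in_itv.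
Qed.

Theorem proposition3p14 (R : realType) (c C : R) (hc : 0 < c) (hcC : c < C)
    (L1 U1 L2 U2 : R -> R -> R)
    (hB1 : barriers c C L1 U1) (hB2 : barriers c C L2 U2)
    (S1 S2 : R -> R) (hS1 : cadlag S1) (hS2 : cadlag S2)
    (X1 K1 X2 K2 : R -> R)
    (hXK1 : skorokhod_solution L1 U1 S1 X1 K1)
    (hXK2 : skorokhod_solution L2 U2 S2 X2 K2) :
  forall T : R, 0 < T ->
    (sup_dist T K1 K2 <=
       (C / c)%:E * sup_dist T S1 S2 +
       (1 / c)%:E * Order.max (sup_dist2 T L1 L2) (sup_dist2 T U1 U2))%E.
Proof.
move=> T T0; have T00 : (0 : R) <= 0 <= T by rewrite lexx ltW.
have Cc0 : 0 < C / c by rewrite divr_gt0// (lt_trans hc).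
have c10 : 0 < 1 / c by rewrite divr_gt0.
have S0 : (0 <= sup_dist T S1 S2)%E.
  apply: (@le_trans _ _ `|S1 0 - S2 0|%:E); first by rewrite lee_fin.
  by apply: ereal_sup_ubound; exists 0 => //=; rewrite in_itv.
have LB t x : 0 <= t <= T -> (`|L1 t x - L2 t x|%:E <=
    Order.max (sup_dist2 T L1 L2) (sup_dist2 T U1 U2))%E.
  by move=> tT; rewrite le_max sup_dist2_ge.
have UB t x : 0 <= t <= T -> (`|U1 t x - U2 t x|%:E <=
    Order.max (sup_dist2 T L1 L2) (sup_dist2 T U1 U2))%E.
  by move=> tT; rewrite le_max sup_dist2_ge ?orbT.
move: LB UB; set m := Order.max _ _ => LB UB.
have m0 : (0 <= m)%E by apply: le_trans (LB 0 0 T00); rewrite lee_fin.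
have SE := @sup_distP R T _ S1 S2.
(* If either supremum is infinite, so is the right-hand side, both terms being nonnegative with
   positive coefficients. *)
case: (sup_dist T S1 S2) S0 SE => [E| |]// E0 SE; last first.
  rewrite gt0_muley ?lte_fin// addye ?leey// gt_eqF// (lt_le_trans ltNy0)//.
  by rewrite mule_ge0// ltW.
case: m m0 LB UB => [B| |]// _ LB UB; last first.
  by rewrite [((1 / c)%:E * _)%E]gt0_muley ?lte_fin// addey ?leey.
apply: ub_ereal_sup => _ [t /= + <-]; rewrite in_itv/= => tT.
have {}SE := SE _ erefl.
have EC : E <= C / c * E.
  by apply: ler_peMl; [rewrite -lee_fin|rewrite ler_pdivlMr// mul1r ltW].
rewrite -!EFinM -EFinD lee_fin; apply: (@le_trans _ _ (E + B / c)).
  rewrite ler_norml lerNl opprB; apply/andP; split.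
    by apply: (increment_bound hc hB2 hB1 hXK2 hXK1 _ _ T) => // u *;
      rewrite distrC; [exact: SE|exact: LB|exact: UB].
  exact: (increment_bound hc hB1 hB2 hXK1 hXK2 _ _ T).
by rewrite div1r [c^-1 * B]mulrC lerD2r.
Qed.
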